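(* Consider the $G/M/\infty$ queue with FIFO-batch or LIFO-batch departures, and suppose that the arrival process is Poisson of rate $\lambda$. Then, for $k\ge 0$, $$\mathbb{P}\{Q(t)=k\}=C_{k,0}+\sum_{i=1}^{k+1}C_{k,i}e^{-(\lambda+i\mu)t},\quad t>0,$$ where the coefficients $C_{k,i}$ can be computed recursively as follows: for $k\ge 0$, $$C_{k,0}=\mathbb{P}\{Q_\infty=k\}=\pi_k,$$ $$(k+1-i)C_{k,i}=\rho C_{k-1,i}-\sum_{l=i-1}^{k-1}C_{l,i},\quad 1\le i\le k,$$ $$C_{k,k+1}=\mathbb{P}\{Q(0)=k\}-\sum_{i=0}^k C_{k,i}.$$
   Context: Model. Customers arrive to an infinite-server system according to a Poisson process of rate $\lambda>0$; each arriving customer immediately starts service at his own server; service times are i.i.d. exponential with parameter $\mu>0$, independent of arrivals. Customers line up in order of arrival. Under FIFO-batch (respectively LIFO-batch) departures, whenever the service of some customer finishes, this customer leaves together with all customers in front of (respectively behind) him. Under either discipline the queue length $Q(\cdot)$ is a continuous-time Markov chain on $\mathbb{Z}_+$ with transition rates $q(i,i+1)=\lambda$, $i\ge 0$, and $q(i,j)=\mu$, $i\ge 1$, $0\le j\le i-1$. Its stationary distribution is $\pi_k=\mathbb{P}\{Q_\infty=k\}$, $k\in\mathbb{Z}_+$. $\rho:=\lambda/\mu$. *)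

(* Defs.v *)
From HB Require Import structures.
From mathcomp Require Import all_boot all_order all_algebra.
From mathcomp Require Import all_classical all_reals all_analysis.

Set Implicit Arguments.
Unset Strict Implicit.
Unset Printing Implicit Defensive.

Import Order.TTheory GRing.Theory Num.Theory.
Import numFieldNormedType.Exports.

Local Open Scope classical_set_scope.
Local Open Scope ring_scope.

(** [p t i j] is the probability of going from [i] to [j] in time [t]; only
    its values at [0 <= t] are meaningful. *)
Record transition_function (R : realType) (p : R -> nat -> nat -> R) : Prop :=
  TransitionFunction {
    tf_ge0 : forall t i j, 0 <= t -> 0 <= p t i j ;
    tf_sum1 : forall t i, 0 <= t -> series (p t i) @ \oo --> (1 : R) ;
    tf_0 : forall i j, p 0 i j = (i == j)%:R ;
    tf_chapman_kolmogorov : forall s t i j, 0 <= s -> 0 <= t ->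
      series (fun l => p s i l * p t l j) @ \oo --> p (s + t) i j }.

(** [p h i j = (i == j) + g i j * h + o(h)] as [h] decreases to [0]; the
    diagonal entries of the generator [g] are [g i i = - \sum_(j != i) g i j],
    the off-diagonal ones are the transition rates. *)
Definition has_generator (R : realType) (p : R -> nat -> nat -> R)
    (g : nat -> nat -> R) : Prop :=
  forall i j, (p h i j - (i == j)%:R) / h @[h --> 0^'+] --> g i j.

(** Time-homogeneous Markov property with respect to [p], for all
    finite-dimensional distributions: the conditional probability is multiplied
    out, so nothing is required of the transitions out of null events. The
    initial distribution is arbitrary, and only the times [0 <= t] matter. *)
Definition markov_process d (T : measurableType d) (R : realType)
    (P : probability T R) (Q : R -> {RV P >-> nat})
    (p : R -> nat -> nat -> R) : Prop :=
  forall (n : nat) (t : nat -> R) (x : nat -> nat),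
    0 <= t 0%N ->
    (forall m, (m <= n)%N -> t m < t m.+1) ->
    P [set w | forall m, (m <= n.+1)%N -> Q (t m) w = x m] =
    (P [set w | forall m, (m <= n)%N -> Q (t m) w = x m] *
     (p (t n.+1 - t n) (x n) (x n.+1))%:E)%E.

Record markov_chain d (T : measurableType d) (R : realType)
    (P : probability T R) (Q : R -> {RV P >-> nat})
    (p : R -> nat -> nat -> R) (g : nat -> nat -> R) : Prop :=
  MarkovChain {
    mc_transition : transition_function p ;
    mc_generator : has_generator p g ;
    mc_markov : markov_process Q p }.

Record stationary_distribution (R : realType) (p : R -> nat -> nat -> R)
    (pi_ : nat -> R) : Prop :=
  StationaryDistribution {
    sd_ge0 : forall k, 0 <= pi_ k ;
    sd_sum1 : series pi_ @ \oo --> (1 : R) ;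
    sd_invariant : forall t j, 0 <= t ->
      series (fun i => pi_ i * p t i j) @ \oo --> pi_ j }.

Inductive batch_discipline := FIFO_batch | LIFO_batch.

(** The [i] customers in the system are numbered [0, ..., i - 1] in order of
    arrival, [0] being the front of the line. The queue length is given just
    after the service of customer [m < i] finishes: under FIFO-batch the
    customers [0, ..., m] leave, under LIFO-batch [m, ..., i - 1] leave. *)
Definition length_after (D : batch_discipline) (i m : nat) : nat :=
  match D with
  | FIFO_batch => i - m.+1
  | LIFO_batch => m
  end.

(** Meaningful for [i != j]: Poisson arrivals at rate [lambda], and service
    completions at rate [mu] for each of the [i] customers present. *)
Definition batch_rate (R : realType) (D : batch_discipline) (lambda mu : R)
    (i j : nat) : R :=
  (if j == i.+1 then lambda else 0) +
  \sum_(m < i | length_after D i m == j) mu.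

Definition batch_generator (R : realType) (D : batch_discipline)
    (lambda mu : R) (i j : nat) : R :=
  if i == j then - (lambda + i%:R * mu) else batch_rate D lambda mu i j.

Lemma batch_generatorE (R : realType) (D : batch_discipline) (lambda mu : R)
    (i j : nat) :
  batch_generator D lambda mu i j =
    if j == i.+1 then lambda
    else if (j < i)%N then mu
    else if j == i then - (lambda + i%:R * mu)
    else 0.
Proof.
rewrite /batch_generator eq_sym; case: (eqVneq j i) => [->|ji].
  by rewrite ltnn (ltn_eqF (ltnSn i)).
rewrite /batch_rate.
have [jlt|jge] := ltnP j i; last first.
  rewrite big_pred0 ?addr0 // => m; apply/negbTE.
  rewrite neq_ltn; apply/orP; left; apply: leq_trans jge.
  case: D => //=; have mi := ltn_ord m.
  by rewrite -subn_gt0 subKn.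
rewrite (ltn_eqF (ltnW jlt : (j < i.+1)%N)) add0r.
have mlt : ((if D is FIFO_batch then i - j.+1 else j) < i)%N.
  by case: D => //; rewrite -subn_gt0 subKn.
rewrite (big_pred1 (Ordinal mlt)) // => m.
rewrite /= -[RHS]val_eqE /=; case: D {mlt} => //=.
have mi := ltn_ord m.
apply/eqP/eqP => [<-|->]; last by rewrite subnSK // subKn // ltnW.
by rewrite subnSK // subKn // ltnW.
Qed.

(** [C k i] is constrained only for [i <= k + 1]; [p0] is the law of [Q(0)]. *)
Record batch_coefficients (R : realType) (rho : R) (pi_ p0 : nat -> R)
    (C : nat -> nat -> R) : Prop :=
  BatchCoefficients {
    bc_0 : forall k, C k 0%N = pi_ k ;
    bc_rec : forall k i, (1 <= i <= k)%N ->
      (k.+1 - i)%:R * C k i =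
        rho * C k.-1 i - \sum_(i.-1 <= l < k) C l i ;
    bc_last : forall k, C k k.+1 = p0 k - \sum_(0 <= i < k.+1) C k i }.

(* Main.v *)
Require Import Defs.
From HB Require Import structures.
From mathcomp Require Import all_boot all_order all_algebra.
From mathcomp Require Import all_classical all_reals all_analysis.
From mathcomp Require Import ring lra.

Import Order.TTheory GRing.Theory Num.Theory.
Import numFieldNormedType.Exports.

Local Open Scope classical_set_scope.
Local Open Scope ring_scope.

(** Under either discipline the queue length has the rates [i -> i + 1] at rate
    [lambda] and [i -> j] at rate [mu] for each [j < i]. As the rate into [k]
    from above does not depend on where one comes from, the forward equation
    for the law [a t] of the queue length closes up on the first coordinates:
    [a' k = lambda a (k - 1) - (lambda + k mu) a k
            + mu (1 - \sum_(l <= k) a l)]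
    ([forward_rhs]). This is a triangular linear system, with diagonal entry
    [- (lambda + (k + 1) mu)], so its solution is determined by [a 0]
    ([forward_uniqueness]), and a combination of the exponentials
    [expR (- (lambda + i mu) t)] and of a constant solves it as soon as the
    coefficients satisfy the announced recursion ([exp_mixture_forward]). The
    constant terms solve the stationary system, which a stationary
    distribution does because it is itself a law that moves with the chain
    ([stationary_forward]); the last coefficient of each row adjusts the
    initial value.

    What needs an argument is that the forward equation holds, since the rates
    out of a state are unbounded and only the derivatives at time 0 of the
    single transition probabilities are given. The backward equation is
    immediate: a row of the generator has finitely many nonzero entries and
    sums to 0, which controls the tail of the Chapman-Kolmogorov series
    ([backward_equation]). For the forward equation, the terms
    [a t i * p h i k / h] must be dominated uniformly in [i]. The bound
    [p h i k <= (lambda + mu) h] for [i != k]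
    ([batch_transition_offdiag_le]) follows from the backward equation by a
    maximum principle. The state space being infinite, the principle is
    applied to the barrier [(lambda + mu) t + e (i + 1 + lambda t)], where the
    Lyapunov function [i + 1 + lambda t] confines the comparison to finitely
    many [i], and [e] tends to 0.

    All derivatives in time are one-sided: the semigroup property gives right
    derivatives at once, and real induction replaces the mean value theorem. *)

(** * Right derivatives and a comparison principle *)

Definition right_derivative {R : realType} (f : R -> R) (t l : R) : Prop :=
  (f (t + h) - f t) / h @[h --> 0^'+] --> l.

Definition left_continuous {R : realType} (f : R -> R) : Prop :=
  forall t, 0 < t -> f (t - h) @[h --> 0^'+] --> f t.

Lemma left_continuous_id {R : realType} : left_continuous (@id R).
Proof.
move=> t t0; apply: cvg_at_right_filter; rewrite -[X in _ --> X]subr0.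
by apply: cvgB; [exact: cvg_cst|exact: cvg_id].
Qed.

Lemma left_continuous_modulus {R : realType} (f w : R -> R) :
  w h @[h --> 0^'+] --> 0 ->
  (forall t h, 0 <= t -> 0 < h -> `|f (t + h) - f t| <= w h) ->
  left_continuous f.
Proof.
move=> w0 fw t t0; apply/cvgrPdist_le => e e0.
near=> h.
have h0 : 0 < h by near: h; exact: nbhs_right_gt.
have ht : h < t by near: h; exact: nbhs_right_lt.
have we : w h <= e by near: h; exact: (cvgr_le _ w0).
apply: le_trans we.
by rewrite -{1}[t](subrK h); apply: fw => //; lra.
Unshelve. all: by end_near. Qed.

(** The supremum [m] of the times up to which [G] holds satisfies [G] by the
    first hypothesis, and the second one then goes past [m]. *)
Lemma real_induction {R : realType} (G : R -> Prop) :
  (forall t, 0 <= t -> (forall s, 0 <= s < t -> G s) -> G t) ->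
  (forall t, 0 <= t -> G t -> \forall h \near 0^'+, G (t + h)) ->
  forall t, 0 <= t -> G t.
Proof.
move=> Gclosed Gopen t t0; apply: contrapT => nGt.
pose A := [set s : R | 0 <= s /\ forall u, 0 <= u <= s -> G u].
have G0 : G 0 by apply: Gclosed => // s; lra.
have A0 : A 0.
  by split=> // u u0; have -> : u = 0 by lra.
have At s : A s -> s <= t.
  move=> [s0 sG]; rewrite leNgt; apply/negP => st.
  by apply: nGt; apply: sG; lra.
have supA : has_sup A by split; [exists 0|exists t].
set m := sup A.
have m0 : 0 <= m by apply: sup_upper_bound.
have belowm s : 0 <= s < m -> G s.
  move=> /andP[s0 sm].
  have [u [u0 uG] us] := @sup_adherent _ A (m - s) ltac:(lra) supA.
  by apply: uG; move: us; rewrite -/m; lra.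
have Gm : G m by exact: Gclosed.
have [e /= e0 eG] := Gopen _ m0 Gm.
have : A (m + e / 2).
  split=> [|u /andP[u0 um]]; first lra.
  have [um'|um'] := ltP u m; first by apply: belowm; lra.
  have [->//|um''] := eqVneq u m.
  have um3 : m < u by rewrite lt_neqAle eq_sym um'' um'.
  rewrite (_ : u = m + (u - m)); last by ring.
  apply: eG => /=; last by lra.
  by rewrite sub0r normrN ger0_norm; lra.
by move=> /(sup_upper_bound supA); rewrite -/m; lra.
Qed.

(** If [f t] is positive, [f] stays so by right continuity; if it is 0, a positive
    right derivative decides. *)
Lemma right_derivative_near_sign {R : realType} (f : R -> R) (t l : R) :
  right_derivative f t l -> 0 <= f t -> (f t = 0 -> 0 < l) ->
  \forall h \near 0^'+, 0 <= f (t + h).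
Proof.
move=> fl ft0 ftl.
have [ft|ft] := eqVneq (f t) 0.
  near=> h.
  have h0 : 0 < h by near: h; exact: nbhs_right_gt.
  have : 0 < (f (t + h) - f t) / h.
    by near: h; move/cvgr_gt: fl; apply; exact: ftl.
  by rewrite pmulr_lgt0 ?invr_gt0// ft subr0 => /ltW.
have {ft} ft : 0 < f t by rewrite lt_neqAle eq_sym ft ft0.
have hc : h * ((f (t + h) - f t) / h) @[h --> 0^'+] --> 0 * l.
  by apply: cvgM => //; apply: cvg_at_right_filter; exact: cvg_id.
near=> h.
have h0 : 0 < h by near: h; exact: nbhs_right_gt.
have : - f t < h * ((f (t + h) - f t) / h).
  by near: h; move/cvgr_gt: hc; apply; rewrite mul0r; lra.
by rewrite mulrC divfK ?gt_eqF//; lra.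
Unshelve. all: by end_near. Qed.

(** A family of functions that starts nonnegative stays so if none of them can
    cross 0 first: where one vanishes while the others are nonnegative, it is
    increasing. The bound [N] makes the family finite for this purpose, so that
    the right neighborhoods on which the [v i] stay nonnegative can be
    intersected. *)
Lemma barrier {R : realType} (v dv : nat -> R -> R) (N : nat) :
  (forall i t, 0 <= t -> (N <= i)%N -> 0 <= v i t) ->
  (forall i, 0 <= v i 0) ->
  (forall i, left_continuous (v i)) ->
  (forall i t, 0 <= t -> right_derivative (v i) t (dv i t)) ->
  (forall i t, 0 <= t -> (forall j, 0 <= v j t) -> v i t = 0 -> 0 < dv i t) ->
  forall i t, 0 <= t -> 0 <= v i t.
Proof.
move=> vN v0 vl vr vs i t t0; move: t t0 i.
apply: real_induction => [t t0 IH i|t t0 Gt].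
- have [->//|tn0] := eqVneq t 0.
  have tp : 0 < t by rewrite lt_neqAle eq_sym tn0.
  apply: (@closed_cvg _ _ _ _ (fun h => v i (t - h)) (fun x => 0 <= x)
    (@closed_ge R 0) _ _ (vl i t tp)).
  near=> h; apply: IH.
  have h0 : 0 < h by near: h; exact: nbhs_right_gt.
  have ht : h < t by near: h; exact: nbhs_right_lt.
  by lra.
- suff : \forall h \near 0^'+, forall i, (i < N)%N -> 0 <= v i (t + h).
    move=> H; near=> h => i.
    have [iN|Ni] := ltnP i N; last first.
      have h0 : 0 < h by near: h; exact: nbhs_right_gt.
      by apply: vN => //; lra.
    by move: i iN; near: h.
  elim: N {vN} => [|N IH]; first by near=> h => i.
  have HN := right_derivative_near_sign _ _ _ (vr N t t0) (Gt N) (vs N t t0 Gt).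
  near=> h => i; rewrite ltnS leq_eqVlt => /orP[/eqP->|iN].
    by near: h.
  by move: i iN; near: h.
Unshelve. all: by end_near. Qed.

Lemma right_derivative_affineB {R : realType} (a b : R) {f : R -> R} {t l : R} :
  right_derivative f t l ->
  right_derivative (fun s => a * s + b - f s) t (a - l).
Proof.
move=> fl.
have : a - (f (t + h) - f t) / h @[h --> 0^'+] --> a - l.
  by apply: cvgB => //; exact: cvg_cst.
apply: cvg_trans.
apply: near_eq_cvg; near=> h.
have h0 : 0 < h by near: h; exact: nbhs_right_gt.
by field; rewrite gt_eqF.
Unshelve. all: by end_near. Qed.

Lemma left_continuous_affineB {R : realType} (a b : R) {f : R -> R} :
  left_continuous f -> left_continuous (fun s => a * s + b - f s).
Proof.
move=> fl t t0; apply: cvgB; last exact: fl.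
apply: cvgD; last exact: cvg_cst.
by apply: cvgM; [exact: cvg_cst|exact: left_continuous_id].
Qed.

(** Comparison of [f] with the barrier [e (1 + t)] for every [e > 0]: where they
    meet, [f] is positive, hence not increasing. *)
Lemma right_derivative_le0 {R : realType} {f l : R -> R} :
  left_continuous f -> f 0 <= 0 ->
  (forall t, 0 <= t -> right_derivative f t (l t)) ->
  (forall t, 0 <= t -> 0 < f t -> l t <= 0) ->
  forall t, 0 <= t -> f t <= 0.
Proof.
move=> fc f0 fl l0 t t0; apply/ler_addgt0Pr => e' e'0; rewrite add0r.
pose e := e' / (1 + t).
have t1 : 0 < 1 + t by lra.
have e0 : 0 < e by rewrite divr_gt0.
have <- : e * t + e = e' by rewrite /e; field; rewrite gt_eqF.
rewrite -subr_ge0.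
apply: (barrier (fun i s => if i is 0%N then e * s + e - f s else 1)
  (fun i s => if i is 0%N then e - l s else 0) 1 _ _ _ _ _ 0%N) => //.
- by case.
- by case => //; rewrite mulr0; lra.
- case; first exact: left_continuous_affineB.
  by move=> _ s s0; exact: cvg_cst.
- case=> [|n] s s0; first by apply: right_derivative_affineB; exact: fl.
  rewrite /right_derivative.
  by under eq_fun do rewrite /= subrr mul0r; exact: cvg_cst.
- case=> [|n] s s0 _; last by move/eqP; rewrite oner_eq0.
  move=> fs; have := l0 s s0.
  have : 0 <= e * s by rewrite mulr_ge0// ltW.
  by move=> es /(_ _); lra.
Qed.

Lemma right_derivative_decay0 {R : realType} (alpha : R) (f : R -> R) :
  0 <= alpha -> left_continuous f -> f 0 = 0 ->
  (forall t, 0 <= t -> right_derivative f t (- alpha * f t)) ->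
  forall t, 0 <= t -> f t = 0.
Proof.
move=> alpha0 fc f0 fl t t0; apply: le_anti; apply/andP; split.
  apply: right_derivative_le0 fc _ fl _ t t0; first by rewrite f0.
  by move=> s s0 fs; rewrite mulNr oppr_le0 mulr_ge0// ltW.
rewrite -oppr_le0.
apply: (@right_derivative_le0 _ (fun s => - f s) (fun s => alpha * f s)) => //.
- by move=> s s0; apply: cvgN; exact: fc.
- by rewrite f0 oppr0.
- move=> s s0; have := right_derivative_affineB 0 0 (fl s s0).
  rewrite sub0r mulNr opprK; congr right_derivative.
  by apply/funext => u; rewrite mul0r add0r sub0r.
- move=> s s0; rewrite oppr_gt0 => fs.
  by rewrite mulr_ge0_le0// ltW.
Qed.

Lemma is_derive_right_derivative {R : realType} {f : R -> R} {t l : R} :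
  is_derive t 1 f l -> right_derivative f t l.
Proof.
move=> [df <-].
have fl : h^-1 *: (f (h *: 1 + t) - f t) @[h --> 0^'+] --> 'D_1 f t.
  exact: cvg_dnbhs_at_right df.
rewrite /right_derivative; apply: cvg_trans fl; apply: near_eq_cvg.
by near=> h; rewrite [RHS]mulrC /GRing.scale/= mulr1 [h + t]addrC.
Unshelve. all: by end_near. Qed.

Lemma right_derivative_exp {R : realType} (r t : R) :
  right_derivative (fun s => expR (- r * s)) t (- r * expR (- r * t)).
Proof.
apply: is_derive_right_derivative; apply: is_derive_eq.
by rewrite /GRing.scale/= mulr1 mulrC.
Qed.

Lemma left_continuous_exp {R : realType} (r : R) :
  left_continuous (fun s => expR (- r * s)).
Proof.
move=> t t0.
have rt : - r * (t - h) @[h --> 0^'+] --> - r * t.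
  by apply: cvgM; [exact: cvg_cst|exact: left_continuous_id].
by apply: (@continuous_cvg _ _ _ _ _ _ expR) => //; exact: continuous_expR.
Qed.

(** * Averages against a probability on the natural numbers *)

Lemma cvg_sum_nat {R : realType} {T : Type} {F : set_system T} {FF : Filter F}
    (f : nat -> T -> R) (l : nat -> R) (m n : nat) :
  (forall i, f i x @[x --> F] --> l i) ->
  \sum_(m <= i < n) f i x @[x --> F] --> \sum_(m <= i < n) l i.
Proof.
move=> fl; elim: (index_iota m n) => [|i r IH].
  by under eq_fun do rewrite big_nil; rewrite big_nil; exact: cvg_cst.
by under eq_fun do rewrite big_cons; rewrite big_cons; exact: cvgD.
Qed.

(** The terms of index at least [n] contribute between 0 and [beta] times the
    mass that [a] leaves there. Chapman-Kolmogorov series are of this form. *)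
Lemma series_mix_bounds {R : realType} (a b : nat -> R) (s beta : R) (n : nat) :
  (forall l, 0 <= a l) -> series a @ \oo --> (1 : R) ->
  (forall l, 0 <= b l) -> (forall l, (n <= l)%N -> b l <= beta) ->
  series (fun l => a l * b l) @ \oo --> s ->
  \sum_(0 <= l < n) a l * b l <= s <=
  \sum_(0 <= l < n) a l * b l + beta * (1 - \sum_(0 <= l < n) a l).
Proof.
move=> a0 a1 b0 bn abs; apply/andP; split.
  apply: (@closed_cvg _ _ _ _ _ (fun x => \sum_(0 <= l < n) a l * b l <= x)
    (@closed_ge R _) _ _ abs).
  near=> m; have nm : (n <= m)%N by near: m; exact: nbhs_infty_ge.
  rewrite [leRHS](@big_cat_nat _ _ _ n)//= lerDl.
  by apply: sumr_ge0 => l _; exact: mulr_ge0.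
have ac : series (fun l => a l * b l) m - beta * series a m @[m --> \oo]
    --> s - beta * 1.
  by apply: cvgB => //; apply: cvgMr.
suff : s - beta * 1 <= \sum_(0 <= l < n) a l * b l
    - beta * \sum_(0 <= l < n) a l by move=> H; lra.
apply: (@closed_cvg _ _ _ _ _ (fun x => x <= \sum_(0 <= l < n) a l * b l
    - beta * \sum_(0 <= l < n) a l) (@closed_le R _) _ _ ac).
near=> m; have nm : (n <= m)%N by near: m; exact: nbhs_infty_ge.
rewrite /series /= (@big_cat_nat _ _ _ n 0 m)//= (@big_cat_nat _ _ _ n 0 m _ a)//=.
have : \sum_(n <= i < m) a i * b i <= beta * \sum_(n <= i < m) a i.
  rewrite mulr_sumr big_nat_cond [leRHS]big_nat_cond.
  apply: ler_sum => i /andP[/andP[ni _] _].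
  by rewrite mulrC ler_wpM2r// bn.
by lra.
Unshelve. all: by end_near. Qed.

Lemma series_mix_bounds1 {R : realType} (a b : nat -> R) (s beta : R) (i : nat) :
  (forall l, 0 <= a l) -> series a @ \oo --> (1 : R) ->
  (forall l, 0 <= b l) -> (forall l, l != i -> b l <= beta) ->
  series (fun l => a l * b l) @ \oo --> s ->
  a i * b i <= s <= a i * b i + beta * (1 - a i).
Proof.
move=> a0 a1 b0 bi abs.
have bn l : (i.+1 <= l)%N -> b l <= beta by move=> il; rewrite bi// gtn_eqF.
have := series_mix_bounds a b s beta i.+1 a0 a1 b0 bn abs.
rewrite !big_nat_recr//=.
have ge0 : 0 <= \sum_(0 <= l < i) a l * b l.
  by apply: sumr_ge0 => l _; exact: mulr_ge0.
have : \sum_(0 <= l < i) a l * b l <= beta * \sum_(0 <= l < i) a l.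
  rewrite mulr_sumr big_nat_cond [leRHS]big_nat_cond.
  apply: ler_sum => l /andP[/andP[_ li] _].
  by rewrite mulrC ler_wpM2r// bi// ltn_eqF.
lra.
Qed.

Lemma partial_sum_le1 {R : realType} (a : nat -> R) (n : nat) :
  (forall l, 0 <= a l) -> series a @ \oo --> (1 : R) ->
  \sum_(0 <= l < n) a l <= 1.
Proof.
move=> a0 a1; rewrite -(cvg_lim _ a1)//.
apply: (nondecreasing_cvgn_le (u_ := series a)); last first.
  by apply/cvg_ex; exists 1.
by apply: nondecreasing_series => l _ _; exact: a0.
Qed.

Lemma term_le1 {R : realType} (a : nat -> R) (n : nat) :
  (forall l, 0 <= a l) -> series a @ \oo --> (1 : R) -> a n <= 1.
Proof.
move=> a0 a1; apply: le_trans (partial_sum_le1 a n.+1 a0 a1).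
by rewrite big_nat_recr//= lerDr; exact: sumr_ge0.
Qed.

(** * Transition functions and the backward equation *)

Lemma transition_le1 {R : realType} {p : R -> nat -> nat -> R}
    (tp : transition_function p) (t : R) (i j : nat) : 0 <= t -> p t i j <= 1.
Proof.
by move=> t0; apply: term_le1 (tf_sum1 tp i t0) => l; exact: tf_ge0 tp _ _ _ t0.
Qed.

Lemma transition_cvg0 {R : realType} {p : R -> nat -> nat -> R}
    {g : nat -> nat -> R} (pg : has_generator p g) (i j : nat) :
  p h i j @[h --> 0^'+] --> ((i == j)%:R : R).
Proof.
have hc : (i == j)%:R + h * ((p h i j - (i == j)%:R) / h) @[h --> 0^'+]
    --> (i == j)%:R + 0 * g i j.
  apply: cvgD; first exact: cvg_cst.
  by apply: cvgM; [apply: cvg_at_right_filter; exact: cvg_id|exact: pg].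
rewrite mul0r addr0 in hc; apply: cvg_trans hc.
apply: near_eq_cvg; near=> h.
have h0 : 0 < h by near: h; exact: nbhs_right_gt.
by rewrite mulrC divfK ?(gt_eqF h0)// addrC subrK.
Unshelve. all: by end_near. Qed.

(** The chain started at [i] is still at [i] after a short time [h] with
    probability close to 1, so that [p (t + h) i k] and [p t i k] differ by at
    most [1 - p h i i], whatever [t] is. *)
Lemma transition_left_continuous {R : realType} {p : R -> nat -> nat -> R}
    {g : nat -> nat -> R} (tp : transition_function p)
    (pg : has_generator p g) (i k : nat) : left_continuous (fun t => p t i k).
Proof.
apply: (left_continuous_modulus _ (fun h => 1 - p h i i)).
  rewrite -[X in _ --> X](subrr (1 : R)); apply: cvgB; first exact: cvg_cst.
  by have := transition_cvg0 pg i i; rewrite eqxx.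
move=> t h t0 h0; have h0' := ltW h0.
have p0 l : 0 <= p t l k by exact: tf_ge0.
have p1 l : l != i -> p t l k <= 1 by move=> _; exact: transition_le1.
have := series_mix_bounds1 (p h i) _ _ 1 i (fun l => tf_ge0 tp i l h0')
  (tf_sum1 tp i h0') p0 p1 (tf_chapman_kolmogorov tp h0' t0).
rewrite addrC ler_norml.
have := p0 i; have := transition_le1 tp t i k t0.
have := tf_ge0 tp i i h0'; have := transition_le1 tp h i i h0'.
by nra.
Qed.

(** In [p (h + t) i k = \sum_j p h i j * p t j k] the terms with [n <= j] add up
    to at most [1 - \sum_(j < n) p h i j], which is [o(h)] because the first [n]
    entries of row [i] of the generator already sum to 0. *)
Lemma backward_equation {R : realType} {p : R -> nat -> nat -> R}
    {g : nat -> nat -> R} (tp : transition_function p)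
    (pg : has_generator p g) (i n k : nat) (t : R) :
  (i < n)%N -> 0 <= t -> \sum_(0 <= j < n) g i j = 0 ->
  right_derivative (fun t => p t i k) t (\sum_(0 <= j < n) g i j * p t j k).
Proof.
move=> iN t0 g0; rewrite /right_derivative.
have p0 l : 0 <= p t l k by exact: tf_ge0.
have p1 l : (n <= l)%N -> p t l k <= 1 by move=> _; exact: transition_le1.
pose main h := \sum_(0 <= j < n) (p h i j - (i == j)%:R) / h * p t j k.
pose rest h := \sum_(0 <= j < n) (p h i j - (i == j)%:R) / h.
have mainc : main h @[h --> 0^'+] --> \sum_(0 <= j < n) g i j * p t j k.
  by apply: cvg_sum_nat => j; apply: cvgM; [exact: pg|exact: cvg_cst].
have restc : main h - rest h @[h --> 0^'+]
    --> \sum_(0 <= j < n) g i j * p t j k.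
  rewrite -[X in _ --> X]subr0 -[X in _ --> _ - X]g0; apply: cvgB => //.
  by apply: cvg_sum_nat => j; exact: pg.
apply: (squeeze_cvgr _ mainc restc).
near=> h.
have h0 : 0 < h by near: h; exact: nbhs_right_gt.
have h0' := ltW h0.
have := series_mix_bounds (p h i) _ _ 1 n (fun l => tf_ge0 tp i l h0')
  (tf_sum1 tp i h0') p0 p1 (tf_chapman_kolmogorov tp h0' t0).
have delta (u : nat -> R) : \sum_(0 <= j < n) (i == j)%:R * u j = u i.
  rewrite big_mkord (bigD1 (Ordinal iN))//= eqxx mul1r big1 ?addr0// => j.
  by rewrite -val_eqE /= eq_sym => /negbTE ->; rewrite mul0r.
have -> : main h = (\sum_(0 <= j < n) p h i j * p t j k - p t i k) / h.
  rewrite -(delta (p t ^~ k)) -sumrB mulr_suml.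
  by apply: eq_bigr => j _; rewrite mulrAC mulrBl.
have -> : rest h = (\sum_(0 <= j < n) p h i j - 1) / h.
  rewrite -(delta (fun=> 1)) -sumrB mulr_suml.
  by apply: eq_bigr => j _; rewrite mulr1.
rewrite -mulrBl !ler_pM2r ?invr_gt0// addrC.
by lra.
Unshelve. all: by end_near. Qed.

(** * The batch generator *)

Lemma batch_row {R : realType} (D : batch_discipline) (lambda mu : R)
    (u : nat -> R) (i : nat) :
  \sum_(0 <= j < i.+2) batch_generator D lambda mu i j * u j =
  lambda * (u i.+1 - u i) + mu * \sum_(0 <= j < i) (u j - u i).
Proof.
rewrite !big_nat_recr//= !batch_generatorE eqxx ltnn eqxx.
rewrite (ltn_eqF (ltnSn i)) sumrB big_const_nat subn0 iter_addr_0.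
rewrite (eq_big_nat _ _ (F2 := fun j => mu * u j)); last first.
  by move=> j /andP[_ ji]; rewrite batch_generatorE ji (ltn_eqF (ltnW ji : (j < i.+1)%N)).
by rewrite -mulr_sumr -[in RHS]mulr_natl; ring.
Qed.

(** The value [a (k - 1)], with [a (- 1) = 0]. *)
Definition prev_term {R : realType} (a : nat -> R) (k : nat) : R :=
  if k is k'.+1 then a k' else 0.

Lemma batch_column {R : realType} (D : batch_discipline) (lambda mu : R)
    (a : nat -> R) (n k : nat) : (k < n)%N ->
  \sum_(0 <= i < n) a i * batch_generator D lambda mu i k =
  lambda * prev_term a k - (lambda + k%:R * mu) * a k
  + mu * \sum_(k.+1 <= i < n) a i.
Proof.
move=> kn; rewrite (@big_cat_nat _ _ _ k.+1)//= big_nat_recr//=.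
rewrite batch_generatorE ltnn eqxx (ltn_eqF (ltnSn k)).
rewrite (eq_big_nat (m := k.+1) _ _ (F2 := fun j => mu * a j)); last first.
  move=> j /andP[kj _]; rewrite batch_generatorE kj mulrC.
  by rewrite (ltn_eqF (ltnW kj : (k < j.+1)%N)).
have -> : \sum_(0 <= i < k) a i * batch_generator D lambda mu i k =
    lambda * prev_term a k.
  case: k {kn} => [|k]; first by rewrite big_geq// /prev_term mulr0.
  rewrite big_nat_recr//= batch_generatorE eqxx /prev_term.
  rewrite big_nat_cond big1 ?add0r 1?mulrC//.
  move=> j /andP[/andP[_ jk] _]; rewrite batch_generatorE eqSS gtn_eqF//.
  by rewrite ltnNge (ltnW (ltnW jk : (j < k.+1)%N))/= gtn_eqF ?mulr0// ltnW.
by rewrite -mulr_sumr; ring.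
Qed.

(** A state [k] is entered from another state at rate [lambda] (from [k - 1]) or
    [mu] (from above), uniformly in the other state. The function
    [(lambda + mu) t + e (j + 1 + lambda t) + (j == k)] of [t] and [j] therefore
    grows strictly faster than the backward equation allows a function below it
    to grow at a point of contact with [j != k]; at [j = k] it exceeds 1, so
    that no contact occurs there. *)
Lemma batch_transition_offdiag_le {R : realType} {D : batch_discipline}
    {lambda mu : R} {p : R -> nat -> nat -> R} (lambda0 : 0 < lambda)
    (mu0 : 0 < mu) (tp : transition_function p)
    (pg : has_generator p (batch_generator D lambda mu)) (t : R) (i k : nat) :
  0 <= t -> i != k -> p t i k <= (lambda + mu) * t.
Proof.
move=> t0 ik; apply/ler_addgt0Pr => e' e'0.
have c0 : 0 < i.+1%:R + lambda * t.
  by rewrite ltr_pwDl// mulr_ge0// ltW.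
pose e := e' / (i.+1%:R + lambda * t).
have e0 : 0 < e by rewrite divr_gt0.
pose v j s := (lambda + mu + e * lambda) * s + (e * j.+1%:R + (j == k)%:R)
  - p s j k.
pose dv j s := lambda + mu + e * lambda -
  \sum_(0 <= l < j.+2) batch_generator D lambda mu j l * p s l k.
suff : 0 <= v i t.
  rewrite /v (negbTE ik)/=.
  have : e * (i.+1%:R + lambda * t) = e' by rewrite /e divfK// gt_eqF.
  by lra.
have el0 : 0 < e * lambda by exact: mulr_gt0.
apply: (barrier v dv (Num.bound e^-1)) => //.
(* beyond [1 / e] the barrier exceeds 1, hence every probability *)
- move=> j s s0 Nj; rewrite /v subr_ge0.
  apply: le_trans (transition_le1 tp s j k s0) _.
  have : 1 <= e * j.+1%:R.
    rewrite -ler_pdivrMl// mulr1; apply: ltW.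
    apply: lt_le_trans (archi_boundP _) _; first by rewrite invr_ge0 ltW.
    by rewrite ler_nat ltnW.
  have : 0 <= (lambda + mu + e * lambda) * s by rewrite mulr_ge0//; lra.
  by have : 0 <= (j == k)%:R :> R; [|lra].
- by move=> j; rewrite /v (tf_0 tp) mulr0 add0r addrK mulr_ge0// ltW.
- by move=> j; apply: left_continuous_affineB; exact: transition_left_continuous pg _ _.
- move=> j s s0; apply: right_derivative_affineB.
  apply: (backward_equation tp pg) => //.
  have := batch_row D lambda mu (fun=> 1) j.
  under eq_bigr do rewrite mulr1.
  move=> ->; rewrite subrr mulr0 add0r big1 ?mulr0// => l _; exact: subrr.
- move=> j s s0 vs vj; rewrite /dv batch_row.
  have [jk|jk] := eqVneq j k.
    exfalso; have := transition_le1 tp s j k s0.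
    have : 0 <= (lambda + mu + e * lambda) * s by rewrite mulr_ge0//; lra.
    have : 0 < e * j.+1%:R by rewrite mulr_gt0.
    by move: vj; rewrite /v jk eqxx/=; lra.
  have up : p s j.+1 k - p s j k <= e + (j.+1 == k)%:R.
    have := vs j.+1; move: vj; rewrite /v (negbTE jk)/=.
    by rewrite -(natr1 j.+1); lra.
  have down l : (l < j)%N -> p s l k - p s j k <= (l == k)%:R.
    move=> lj; have := vs l; move: vj; rewrite /v (negbTE jk)/=.
    have : e * l.+1%:R <= e * j.+1%:R by rewrite ler_pM2l// ler_nat ltnW.
    by lra.
  have downs : \sum_(0 <= l < j) (p s l k - p s j k) <= (k < j)%:R.
    apply: (@le_trans _ _ (\sum_(0 <= l < j) (l == k)%:R)).
      rewrite big_nat_cond [leRHS]big_nat_cond.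
      by apply: ler_sum => l /andP[/andP[_ lj] _]; exact: down.
    have [kj|kj] := ltnP k j.
      by rewrite big_mkord (bigD1 (Ordinal kj))//= eqxx big1 ?addr0// => l /negbTE;
        rewrite -val_eqE/= => ->.
    rewrite big_nat_cond big1// => l /andP[/andP[_ lj] _].
    by rewrite ltn_eqF// (leq_trans lj).
  have : lambda * (p s j.+1 k - p s j k) <= lambda * (e + (j.+1 == k)%:R).
    by rewrite ler_pM2l.
  have : mu * (\sum_(0 <= l < j) (p s l k - p s j k)) <= mu * (k < j)%:R.
    by rewrite ler_pM2l.
  (* from [j] only one of the two moves reaches [k] *)
  have [<-|jk1] := eqVneq j.+1 k; first by rewrite ltnNge leqnSn/=; lra.
  by case: (k < j)%N => /=; lra.
Qed.

(** * The forward equation *)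

(** The inflow [mu \sum_(l > k) u l] from above is written through the total
    mass 1, which leaves only the coordinates up to [k]. *)
Definition forward_rhs {R : realType} (lambda mu : R) (u : nat -> R) (k : nat) : R :=
  lambda * prev_term u k - (lambda + k%:R * mu) * u k
  + mu * (1 - \sum_(0 <= l < k.+1) u l).

(** The laws that move with the chain, whatever their origin: the law of the
    queue length and a stationary distribution are both instances. *)
Record evolution {R : realType} (p : R -> nat -> nat -> R)
    (a : R -> nat -> R) : Prop := Evolution {
  ev_ge0 : forall t i, 0 <= t -> 0 <= a t i;
  ev_sum1 : forall t, 0 <= t -> series (a t) @ \oo --> (1 : R);
  ev_step : forall t h j, 0 <= t -> 0 < h ->
    series (fun i => a t i * p h i j) @ \oo --> a (t + h) j }.

(** During a time [h], state [k] loses at most the fraction [1 - p h k k] of its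
    mass and gains at most [(lambda + mu) h]. *)
Lemma evolution_left_continuous {R : realType} {D : batch_discipline}
    {lambda mu : R} {p : R -> nat -> nat -> R} (lambda0 : 0 < lambda)
    (mu0 : 0 < mu) (tp : transition_function p)
    (pg : has_generator p (batch_generator D lambda mu)) (a : R -> nat -> R)
    (k : nat) :
  evolution p a -> left_continuous (fun t => a t k).
Proof.
move=> [a0 a1 astep].
apply: (left_continuous_modulus _ (fun h => (1 - p h k k) + (lambda + mu) * h)).
  rewrite [X in _ --> X](_ : 0 = (1 - 1) + (lambda + mu) * 0); last by ring.
  apply: cvgD.
    apply: cvgB; first exact: cvg_cst.
    by have := transition_cvg0 pg k k; rewrite eqxx.
  apply: cvgM; first exact: cvg_cst.
  by apply: cvg_at_right_filter; exact: cvg_id.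
move=> t h t0 h0; have h0' := ltW h0.
have p0 l : 0 <= p h l k by exact: tf_ge0.
have off l : l != k -> p h l k <= (lambda + mu) * h.
  exact: batch_transition_offdiag_le pg _ _ _ _.
have := series_mix_bounds1 (a t) _ _ _ k (fun l => a0 t l t0) (a1 t t0) p0 off
  (astep t h k t0 h0).
have ch0 : 0 <= (lambda + mu) * h by rewrite mulr_ge0// ltW// addr_gt0.
have := a0 t k t0; have := term_le1 (a t) k (fun l => a0 t l t0) (a1 t t0).
have := p0 k; have := transition_le1 tp h k k h0'.
by rewrite ler_norml; nra.
Qed.

(** The difference quotient of [a t k] is the sum over [i] of
    [a t i * (p h i k - (i == k)%:R) / h]. Its first [n] terms converge to the
    corresponding part of column [k] of the generator; the others are at most
    [(lambda + mu) * a t i] by [batch_transition_offdiag_le], so their sum is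
    small, uniformly in [h], when [n] is large. *)
Lemma forward_equation {R : realType} {D : batch_discipline}
    {lambda mu : R} {p : R -> nat -> nat -> R} (lambda0 : 0 < lambda)
    (mu0 : 0 < mu) (tp : transition_function p)
    (pg : has_generator p (batch_generator D lambda mu)) (a : R -> nat -> R)
    (k : nat) (t : R) :
  evolution p a -> 0 <= t ->
  right_derivative (fun t => a t k) t (forward_rhs lambda mu (a t) k).
Proof.
move=> [a0 a1 astep] t0; rewrite /forward_rhs; set L := (X in right_derivative _ _ X).
apply/cvgrPdist_le => e e0.
have c0 : 0 < lambda + mu by exact: addr_gt0.
have at0 l : 0 <= a t l by exact: a0.
have at1 n := partial_sum_le1 (a t) n at0 (a1 t t0).
have [n kn Sn] : exists2 n, (k < n)%N &
    (lambda + mu) * (1 - \sum_(0 <= i < n) a t i) <= e / 2.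
  have S1 : (lambda + mu) * (1 - series (a t) n) @[n --> \oo]
      --> (lambda + mu) * (1 - 1).
    apply: cvgM; first exact: cvg_cst.
    by apply: cvgB; [exact: cvg_cst|exact: a1].
  near \oo => n; exists n; first by near: n; exact: nbhs_infty_gt.
  near: n; apply: (cvgr_le _ S1); rewrite subrr mulr0; lra.
pose main h := \sum_(0 <= i < n) a t i * ((p h i k - (i == k)%:R) / h).
have mainc : main h @[h --> 0^'+] -->
    \sum_(0 <= i < n) a t i * batch_generator D lambda mu i k.
  by apply: cvg_sum_nat => j; apply: cvgM; [exact: cvg_cst|exact: pg].
have LE : L = \sum_(0 <= i < n) a t i * batch_generator D lambda mu i k
    + mu * (1 - \sum_(0 <= i < n) a t i).
  by rewrite batch_column// /L (@big_cat_nat _ _ _ k.+1 0 n)//=; ring.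
near=> h.
have h0 : 0 < h by near: h; exact: nbhs_right_gt.
have h0' := ltW h0.
have : `|\sum_(0 <= i < n) a t i * batch_generator D lambda mu i k - main h|
    <= e / 2.
  near: h; move/cvgrPdist_le: mainc; apply; lra.
have p0 l : 0 <= p h l k by exact: tf_ge0.
have off l : (n <= l)%N -> p h l k <= (lambda + mu) * h.
  move=> nl; apply: (batch_transition_offdiag_le _ _ tp pg) => //.
  by rewrite gtn_eqF// (leq_trans kn).
have /andP[lo hi] := series_mix_bounds (a t) _ _ _ n at0 (a1 t t0) p0 off
  (astep t h k t0 h0).
have mainE : main h = (\sum_(0 <= i < n) a t i * p h i k - a t k) / h.
  have delta : \sum_(0 <= i < n) a t i * (i == k)%:R = a t k.
    rewrite big_mkord (bigD1 (Ordinal kn))//= eqxx mulr1 big1 ?addr0// => j.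
    by rewrite -val_eqE /= => /negbTE ->; rewrite mulr0.
  rewrite -delta -sumrB mulr_suml.
  by apply: eq_bigr => j _; rewrite mulrA mulrBr.
have : main h <= (a (t + h) k - a t k) / h.
  by rewrite mainE ler_pM2r ?invr_gt0//; lra.
have : (a (t + h) k - a t k) / h <=
    main h + (lambda + mu) * (1 - \sum_(0 <= i < n) a t i).
  rewrite mainE ler_pdivrMr// mulrDl divfK ?(gt_eqF h0)//; lra.
have : mu * (1 - \sum_(0 <= i < n) a t i) <=
    (lambda + mu) * (1 - \sum_(0 <= i < n) a t i).
  by rewrite ler_wpM2r ?subr_ge0//; lra.
have : 0 <= mu * (1 - \sum_(0 <= i < n) a t i).
  by rewrite mulr_ge0 ?subr_ge0// ltW.
by rewrite LE !ler_norml; lra.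
Unshelve. all: by end_near. Qed.

(** The constant evolution [pi_] has derivative 0. *)
Lemma stationary_forward {R : realType} {D : batch_discipline}
    {lambda mu : R} {p : R -> nat -> nat -> R} (lambda0 : 0 < lambda)
    (mu0 : 0 < mu) (tp : transition_function p)
    (pg : has_generator p (batch_generator D lambda mu)) (pi_ : nat -> R) :
  stationary_distribution p pi_ -> forall k, forward_rhs lambda mu pi_ k = 0.
Proof.
move=> spi k.
have epi : evolution p (fun=> pi_).
  split=> [t i _|t _|t h j _ h0]; first exact: sd_ge0 spi i.
    exact: sd_sum1 spi.
  exact: sd_invariant spi _ _ (ltW h0).
have /(cvg_lim (@Rhausdorff R)) <- := forward_equation lambda0 mu0 tp pg _ k 0 epi (lexx 0).
by rewrite subrr; under eq_fun do rewrite mul0r; exact: lim_cst.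
Qed.

(** The system is triangular: once the coordinates below [k] agree, the
    difference [e] of the coordinates [k] satisfies
    [e' = - (lambda + (k + 1) mu) e] and vanishes at 0. *)
Lemma forward_uniqueness {R : realType} {lambda mu : R} {a c : R -> nat -> R} :
  0 <= lambda -> 0 <= mu ->
  (forall k, left_continuous (fun t => a t k)) ->
  (forall k, left_continuous (fun t => c t k)) ->
  (forall k t, 0 <= t ->
    right_derivative (fun t => a t k) t (forward_rhs lambda mu (a t) k)) ->
  (forall k t, 0 <= t ->
    right_derivative (fun t => c t k) t (forward_rhs lambda mu (c t) k)) ->
  (forall k, a 0 k = c 0 k) ->
  forall k t, 0 <= t -> a t k = c t k.
Proof.
move=> lambda0 mu0 al cl ar cr ac0 k; elim/ltn_ind: k => k IH t t0.
apply/eqP; rewrite -subr_eq0; apply/eqP.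
apply: (right_derivative_decay0 (lambda + k.+1%:R * mu) (fun t => a t k - c t k)) => //.
- by rewrite addr_ge0// mulr_ge0.
- by move=> s s0; apply: cvgB; [exact: al|exact: cl].
- by rewrite ac0 subrr.
move=> s s0; rewrite /right_derivative.
rewrite [X in _ --> X](_ : _ = forward_rhs lambda mu (a s) k
    - forward_rhs lambda mu (c s) k); last first.
  have prevE : prev_term (a s) k = prev_term (c s) k.
    by rewrite /prev_term; case: k IH => // k IH; apply: IH.
  rewrite /forward_rhs prevE !big_nat_recr//=.
  rewrite (eq_big_nat _ _ (F2 := c s)); last first.
    by move=> l /andP[_ lk]; exact: IH.
  by rewrite -(natr1 k); ring.
have : (a (s + h) k - a s k) / h - (c (s + h) k - c s k) / h @[h --> 0^'+]
    --> forward_rhs lambda mu (a s) k - forward_rhs lambda mu (c s) k.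
  by apply: cvgB; [exact: ar|exact: cr].
apply: cvg_trans.
by apply: near_eq_cvg; near=> h; ring.
Unshelve. all: by end_near. Qed.

(** * The coefficients and the exponential solution *)

(** The entries with [k + 1 < i], which the recursion leaves free, are taken to
    be 0: sums over [i] may then be extended to a range common to several
    rows. *)
Lemma batch_coefficients_exist {R : realType} (rho : R) (pi_ p0 : nat -> R) :
  exists C : nat -> nat -> R,
    batch_coefficients rho pi_ p0 C /\ forall k i, (k.+1 < i)%N -> C k i = 0.
Proof.
pose row_upto (T : nat -> nat -> R) (k i : nat) : R :=
  if i == 0%N then pi_ k
  else if (i <= k)%N then
    (rho * T k.-1 i - \sum_(i.-1 <= l < k) T l i) / (k.+1 - i)%:R
  else 0.
pose full_row (T : nat -> nat -> R) (k i : nat) : R :=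
  if i == k.+1 then p0 k - \sum_(0 <= j < k.+1) row_upto T k j
  else row_upto T k i.
(* [table n] holds the rows below [n]; row [k] is computed from [table k] *)
pose table := fix table n : nat -> nat -> R :=
  if n is k.+1 then fun l => if l == k then full_row (table k) k else table k l
  else fun _ _ => 0.
pose C k := table k.+1 k.
have tableE n l : (l < n)%N -> table n l = C l.
  elim: n => // n IH; rewrite ltnS leq_eqVlt => /orP[/eqP->//|ln] /=.
  by rewrite ltn_eqF// IH.
have CE k : C k = full_row (table k) k by rewrite /C /= eqxx.
have Clow k i : (i <= k)%N -> C k i = row_upto (table k) k i.
  by move=> ik; rewrite CE /full_row ltn_eqF.
exists C; split; first split => [k|k i /andP[i0 ik]|k].
- by rewrite Clow.
- rewrite Clow// /row_upto gtn_eqF// ik mulrC divfK; last first.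
    by rewrite pnatr_eq0 -lt0n subn_gt0.
  rewrite tableE; last by rewrite prednK ?(leq_trans i0).
  by congr (_ - _); apply: eq_big_nat => l /andP[_ lk]; rewrite tableE.
- rewrite [in LHS]CE /full_row eqxx; congr (_ - _).
  by apply: eq_big_nat => j /andP[_ jk]; rewrite Clow.
- move=> k i ki; rewrite CE /full_row gtn_eqF// /row_upto gtn_eqF; last first.
    exact: leq_ltn_trans ki.
  by rewrite leqNgt (ltnW ki).
Qed.

Lemma batch_coefficients_unique {R : realType} {rho : R} {p0 pi_ : nat -> R}
    {C C' : nat -> nat -> R} :
  batch_coefficients rho pi_ p0 C -> batch_coefficients rho pi_ p0 C' ->
  forall k i, (i <= k.+1)%N -> C' k i = C k i.
Proof.
move=> HC HC' k; elim/ltn_ind: k => k IH.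
have low i : (i <= k)%N -> C' k i = C k i.
  case: i => [|i] ik; first by rewrite (bc_0 HC) (bc_0 HC').
  have ik' : (1 <= i.+1 <= k)%N by [].
  have d0 : (k.+1 - i.+1)%:R != 0 :> R by rewrite pnatr_eq0 -lt0n subn_gt0.
  apply: (mulfI d0); rewrite (bc_rec HC ik') (bc_rec HC' ik'); congr (_ * _ - _).
    by rewrite IH ?prednK// (leq_trans _ ik).
  by apply: eq_big_nat => l /andP[il lk]; rewrite IH.
move=> i; rewrite leq_eqVlt => /orP[/eqP->|]; last exact: low.
rewrite (bc_last HC) (bc_last HC'); congr (_ - _).
by apply: eq_big_nat => j /andP[_ jk]; exact: low.
Qed.

(** Index 0 is that of the constant term of the solution. *)
Definition batch_exponent {R : realType} (lambda mu : R) (i : nat) : R :=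
  if i is 0%N then 0 else lambda + i%:R * mu.

(** The coefficient of [expR (- batch_exponent lambda mu i * t)] on both sides of
    the forward equation: for [i = 0] this is the stationary equation, for
    [1 <= i <= k] the recursion multiplied by [mu], and for [i = k + 1] it holds
    for every value of [C k (k + 1)], because the exponent is minus the diagonal
    entry of the system; this is why that coefficient is free to match the
    initial law. *)
Lemma coefficient_identity {R : realType} {lambda mu : R} {p0 pi_ : nat -> R}
    {C : nat -> nat -> R} (mu0 : 0 < mu) :
  batch_coefficients (lambda / mu) pi_ p0 C ->
  (forall k i, (k.+1 < i)%N -> C k i = 0) ->
  (forall k, forward_rhs lambda mu pi_ k = 0) ->
  forall k i, - batch_exponent lambda mu i * C k i =
    lambda * prev_term (C ^~ i) k - (lambda + k%:R * mu) * C k i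
    + mu * ((i == 0%N)%:R - \sum_(0 <= l < k.+1) C l i).
Proof.
move=> HC C0 pis k [|i].
  have Cpi : pi_ = C ^~ 0%N by apply/funext => l; rewrite (bc_0 HC).
  by have := pis k; rewrite /forward_rhs Cpi /= oppr0 mul0r => ->.
rewrite /= sub0r big_nat_recr//=.
have vanish l : (l < i)%N -> C l i.+1 = 0 by move=> li; rewrite C0.
have [ik|ki] := leqP i.+1 k; last first.
  have prev0 : prev_term (C^~ i.+1) k = 0.
    by case: k ki => //= k ki; rewrite vanish.
  have -> : \sum_(0 <= l < k) C l i.+1 = 0.
    rewrite big_nat_cond big1// => l /andP[/andP[_ lk] _].
    by rewrite vanish// (leq_trans lk).
  rewrite prev0; move: ki; rewrite ltnS leq_eqVlt => /orP[/eqP->|ki].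
    by rewrite -natr1; ring.
  by rewrite vanish//; ring.
have pastE : \sum_(0 <= l < k) C l i.+1 = \sum_(i <= l < k) C l i.+1.
  rewrite (@big_cat_nat _ _ _ i)//= ?(ltnW ik)// big_nat_cond big1 ?add0r//.
  by move=> l /andP[/andP[_ li] _]; exact: vanish.
have prevE : prev_term (C^~ i.+1) k = C k.-1 i.+1 by case: k ik {pastE}.
have := bc_rec HC (ik : (1 <= i.+1 <= k)%N).
rewrite pastE prevE natrB; last exact: ltnW.
move/(congr1 ( *%R mu)); rewrite mulrBr (mulrA mu (lambda / mu)).
rewrite [mu * (lambda / mu)]mulrC divfK ?gt_eqF//.
by rewrite -!natr1 => H; lra.
Qed.

Definition exp_mixture {R : realType} (lambda mu : R) (C : nat -> nat -> R)
    (t : R) (k : nat) : R :=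
  \sum_(0 <= i < k.+2) C k i * expR (- batch_exponent lambda mu i * t).

Lemma exp_mixture_right_derivative {R : realType} (lambda mu : R)
    (C : nat -> nat -> R) (k : nat) (t : R) :
  right_derivative (fun t => exp_mixture lambda mu C t k) t
    (\sum_(0 <= i < k.+2) - batch_exponent lambda mu i * C k i *
       expR (- batch_exponent lambda mu i * t)).
Proof.
rewrite /right_derivative /exp_mixture.
under eq_fun do rewrite -sumrB mulr_suml.
apply: cvg_sum_nat => i.
rewrite [X in _ --> X](_ : _ = C k i * (- batch_exponent lambda mu i *
  expR (- batch_exponent lambda mu i * t))); last by ring.
under eq_fun do rewrite -mulrBr -mulrA.
by apply: cvgM; [exact: cvg_cst|exact: right_derivative_exp].
Qed.

Lemma exp_mixture_left_continuous {R : realType} (lambda mu : R)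
    (C : nat -> nat -> R) (k : nat) :
  left_continuous (fun t => exp_mixture lambda mu C t k).
Proof.
move=> t t0; apply: cvg_sum_nat => i.
by apply: cvgM; [exact: cvg_cst|exact: left_continuous_exp].
Qed.

Lemma exp_mixture_wide {R : realType} (lambda mu : R)
    (C : nat -> nat -> R) (t : R) (k n : nat) :
  (forall k i, (k.+1 < i)%N -> C k i = 0) -> (k.+1 < n)%N ->
  exp_mixture lambda mu C t k =
  \sum_(0 <= i < n) C k i * expR (- batch_exponent lambda mu i * t).
Proof.
move=> C0 kn; rewrite (@big_cat_nat _ _ _ k.+2 0 n)//=.
rewrite [X in _ + X]big_nat_cond [X in _ + X]big1 ?addr0// => i /andP[/andP[ki _] _].
by rewrite C0// mul0r.
Qed.

Lemma exp_mixture_forward {R : realType} {lambda mu : R} {p0 pi_ : nat -> R}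
    {C : nat -> nat -> R} (mu0 : 0 < mu) :
  batch_coefficients (lambda / mu) pi_ p0 C ->
  (forall k i, (k.+1 < i)%N -> C k i = 0) ->
  (forall k, forward_rhs lambda mu pi_ k = 0) ->
  forall k t, right_derivative (fun t => exp_mixture lambda mu C t k) t
    (forward_rhs lambda mu (exp_mixture lambda mu C t) k).
Proof.
move=> HC C0 pis k t.
have wide l : (l <= k)%N -> exp_mixture lambda mu C t l =
    \sum_(0 <= i < k.+2) C l i * expR (- batch_exponent lambda mu i * t).
  by move=> lk; apply: exp_mixture_wide.
pose W i := expR (- batch_exponent lambda mu i * t).
have prevE : prev_term (exp_mixture lambda mu C t) k =
    \sum_(0 <= i < k.+2) prev_term (C ^~ i) k * W i.
  rewrite /prev_term; case: k wide => [|k] wide; last exact: wide.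
  by rewrite big1// => i _; rewrite mul0r.
have sumE : 1 - \sum_(0 <= l < k.+1) exp_mixture lambda mu C t l =
    \sum_(0 <= i < k.+2) ((i == 0%N)%:R - \sum_(0 <= l < k.+1) C l i) * W i.
  rewrite (eq_big_nat _ _ (F2 := fun l => \sum_(0 <= i < k.+2) C l i * W i)).
    rewrite exchange_big_nat/=; under [RHS]eq_bigr do rewrite mulrBl mulr_suml.
    rewrite sumrB; congr (_ - _).
    rewrite big_nat_recl//= mul1r /W oppr0 mul0r expR0 big1 ?addr0// => i _.
    by rewrite mul0r.
  by move=> l /andP[_ lk]; exact: wide.
rewrite /forward_rhs sumE prevE wide// !mulr_sumr -sumrB -big_split/=.
rewrite [X in right_derivative _ _ X](_ : _ = \sum_(0 <= i < k.+2)
   - batch_exponent lambda mu i * C k i * W i).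
  exact: exp_mixture_right_derivative.
apply: eq_bigr => i _.
by rewrite (coefficient_identity mu0 HC C0 pis) /W; ring.
Qed.

(** * The law of the queue length *)

Lemma probability_series {d} {T : measurableType d} {R : realType}
    (P : probability T R) (E : nat -> set T) :
  (forall i, measurable (E i)) -> trivIset setT E ->
  series (fun i => fine (P (E i))) @ \oo --> fine (P (\bigcup_i E i)).
Proof.
move=> mE tE.
have mU : measurable (\bigcup_i E i) by exact: bigcupT_measurable.
have : (\sum_(0 <= i < n) P (E i))%E @[n --> \oo]
    --> (fine (P (\bigcup_i E i)))%:E.
  rewrite fineK ?fin_num_measure//.
  exact: (@measure_semi_sigma_additive _ _ _ P).
move/fine_cvg; apply: cvg_trans; apply: near_eq_cvg; near=> n.
by rewrite /series/= sum_fine// => i _; exact: fin_num_measure.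
Unshelve. all: by end_near. Qed.

(** Chapman-Kolmogorov for the law: the event [Q (t + h) = j] is split according
    to the value of [Q t], and the Markov property is used with the two times
    [t] and [t + h]. *)
Lemma markov_chain_evolution {d} {T : measurableType d} {R : realType}
    {P : probability T R} {Q : R -> {RV P >-> nat}} {p : R -> nat -> nat -> R}
    {g : nat -> nat -> R} :
  markov_chain Q p g ->
  evolution p (fun t k => fine (P [set w | Q t w = k])).
Proof.
move=> mc.
have mQ t k : measurable [set w | Q t w = k].
  exact: (measurable_funPTI (Q t) (Y := [set k])).
split=> [t i _|t _|t h j t0 h0]; first exact: fine_ge0.
  have := probability_series P (fun k => [set w | Q t w = k]) (mQ t).
  rewrite (_ : \bigcup_i _ = setT) ?probability_setT; first apply.
    apply/trivIsetP => i j _ _ ij; apply/seteqP; split=> // w [/= Qi Qj].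
    by move: ij; rewrite -Qi -Qj eqxx.
  by apply/seteqP; split=> // w _; exists (Q t w).
pose E i := [set w | Q t w = i] `&` [set w | Q (t + h) w = j].
have PE i : fine (P (E i)) = fine (P [set w | Q t w = i]) * p h i j.
  pose s m := if m is 0%N then t else t + m%:R * h.
  pose x m := if m is 0%N then i else j.
  have := @mc_markov _ _ _ _ _ _ _ mc 0%N s x t0.
  rewrite [X in P X = _](_ : _ = E i); last first.
    apply/seteqP; split=> w /=.
      by move=> H; split; [exact: (H 0%N)|move: (H 1%N isT); rewrite /= mul1r].
    by move=> [Qi Qj] [|[|]]//= _; rewrite mul1r.
  rewrite [X in (P X * _)%E](_ : _ = [set w | Q t w = i]); last first.
    by apply/seteqP; split=> w /= H; [exact: (H 0%N)|case].
  rewrite /= mul1r addrAC subrr add0r => ->.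
    by rewrite fineM// fin_num_measure.
  by case=> //= _; rewrite mul1r; lra.
rewrite (_ : (fun i => _ * _) = fun i => fine (P (E i))); last exact/funext.
have -> : [set w | Q (t + h) w = j] = \bigcup_i E i.
  apply/seteqP; split=> [w Qj|w [i _ []]//].
  by exists (Q t w).
apply: probability_series => [i|]; first exact: measurableI.
apply/trivIsetP => i i' _ _ ii'; apply/seteqP; split=> // w [[/= Qi _] [Qi' _]].
by move: ii'; rewrite -Qi -Qi' eqxx.
Unshelve. all: by end_near. Qed.

Theorem lemma5 (R : realType) (d : measure_display) (T : measurableType d)
    (P : probability T R) (D : batch_discipline) (lambda mu : R)
    (lambda_gt0 : 0 < lambda) (mu_gt0 : 0 < mu)
    (Q : R -> {RV P >-> nat}) (p : R -> nat -> nat -> R)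
    (Q_chain : markov_chain Q p (batch_generator D lambda mu))
    (pi_ : nat -> R) (pi_stationary : stationary_distribution p pi_) :
  exists C : nat -> nat -> R,
    let p0 := fun k => fine (P [set w | Q 0 w = k]) in
    [/\ batch_coefficients (lambda / mu) pi_ p0 C,
        forall C' : nat -> nat -> R,
          batch_coefficients (lambda / mu) pi_ p0 C' ->
          forall k i, (i <= k.+1)%N -> C' k i = C k i
      & forall (k : nat) (t : R), 0 < t ->
          P [set w | Q t w = k] =
          (C k 0%N +
           \sum_(1 <= i < k.+2) C k i * expR (- (lambda + i%:R * mu) * t))%:E ].
Proof.
have [tp pg _] := Q_chain.
pose p0 k := fine (P [set w | Q 0 w = k]).
have [C [HC C0]] := batch_coefficients_exist (lambda / mu) pi_ p0.
exists C => /=; split=> // [C' HC'|k t t0].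
  exact: batch_coefficients_unique HC HC'.
have ev := markov_chain_evolution Q_chain.
have pis := stationary_forward lambda_gt0 mu_gt0 tp pg pi_ pi_stationary.
have init l : p0 l = exp_mixture lambda mu C 0 l.
  rewrite /exp_mixture; under eq_bigr do rewrite mulr0 expR0 mulr1.
  by rewrite big_nat_recr//= (bc_last HC) addrC subrK.
have law := forward_uniqueness (ltW lambda_gt0) (ltW mu_gt0)
  (fun l => evolution_left_continuous lambda_gt0 mu_gt0 tp pg _ l ev)
  (exp_mixture_left_continuous lambda mu C)
  (fun l s s0 => forward_equation lambda_gt0 mu_gt0 tp pg _ l s ev s0)
  (fun l s _ => exp_mixture_forward mu_gt0 HC C0 pis l s) init k t (ltW t0).
have mQ : measurable [set w | Q t w = k].
  exact: (measurable_funPTI (Q t) (Y := [set k])).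
rewrite -[LHS]fineK ?fin_num_measure// law /exp_mixture [in LHS]big_ltn//=.
rewrite oppr0 mul0r expR0 mulr1; congr (_ + _)%:E.
by apply: eq_big_nat => -[].
Qed.
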